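(* Let $\mathcal{H}_1,\mathcal{H}_2$ be Hilbert spaces, let $\Psi=(\psi_k)$ be a Riesz basis for $\mathcal{H}_1$ and $\Phi=(\phi_k)$ a Riesz basis for $\mathcal{H}_2$, with canonical duals $\tilde\Psi$ and $\tilde\Phi$. The functions $$\mathcal{M}^{(\Phi,\Psi)}:\mathcal{B}(\mathcal{H}_1,\mathcal{H}_2)\to\mathcal{B}(l^2,l^2)\quad\text{and}\quad\mathcal{O}^{(\tilde\Phi,\tilde\Psi)}:\mathcal{B}(l^2,l^2)\to\mathcal{B}(\mathcal{H}_1,\mathcal{H}_2)$$ between $\mathcal{B}(\mathcal{H}_1,\mathcal{H}_2)$ and the infinite matrices in $\mathcal{B}(l^2,l^2)$ are bijective, and they are inverse to each other. For $\mathcal{H}_1=\mathcal{H}_2$ the identity is mapped on the identity by $\mathcal{M}^{(\Phi,\Psi)}$ and $\mathcal{O}^{(\tilde\Phi,\tilde\Psi)}$. If furthermore $\Psi=\Phi$ (with $\mathcal{H}_1=\mathcal{H}_2=\mathcal{H}$), then $\mathcal{M}^{(\Phi,\tilde\Phi)}$ and $\mathcal{O}^{(\Phi,\tilde\Phi)}$ are Banach algebra isomorphisms between $\mathcal{B}(\mathcal{H},\mathcal{H})$ and $\mathcal{B}(l^2,l^2)$, respecting the identities $\mathrm{id}_{l^2}$ and $\mathrm{id}_{\mathcal{H}}$.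
   Context: Hilbert spaces are complex and infinite-dimensional, with inner product linear in the first argument. Sequences are indexed by a countable set $K$ and $l^2=l^2(K)$. $\mathcal{B}(X,Y)$ is the space of bounded linear operators from $X$ to $Y$. Bounded operators on $l^2$ are identified with the infinite matrices defining them via $(Mc)_j=\sum_k M_{j,k}c_k$; the product in $\mathcal{B}(l^2,l^2)$ is the matrix product and the product in $\mathcal{B}(\mathcal{H},\mathcal{H})$ is composition. A complete sequence $(\psi_k)$ in $\mathcal{H}$ is a Riesz basis if there are $A,B>0$ with $A\|c\|_2^2\le\|\sum_k c_k\psi_k\|^2\le B\|c\|_2^2$ for all finite sequences $(c_k)$. A Riesz basis is a frame, so its frame operator $Sf=\sum_k\langle f,\psi_k\rangle\psi_k$ is bounded and invertible, and its canonical dual is $\tilde\Psi=(\tilde\psi_k)=(S^{-1}\psi_k)$. For Bessel sequences $\Psi$ in $\mathcal{H}_1$ and $\Phi$ in $\mathcal{H}_2$ (sequences with $\sum_k|\langle f,\psi_k\rangle|^2\le B\|f\|^2$ for all $f$, and similarly for $\Phi$): - $\mathcal{M}^{(\Phi,\Psi)}(O)$ is the matrix $(\mathcal{M}^{(\Phi,\Psi)}(O))_{m,n}=\langle O\psi_n,\phi_m\rangle$ for $O\in\mathcal{B}(\mathcal{H}_1,\mathcal{H}_2)$. - $\mathcal{O}^{(\Phi,\Psi)}(M)$ is the operator $h\mapsto\sum_k\left(\sum_j M_{k,j}\langle h,\psi_j\rangle\right)\phi_k$ from $\mathcal{H}_1$ to $\mathcal{H}_2$ for $M\in\mathcal{B}(l^2,l^2)$.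 A Banach algebra isomorphism here is a bijective linear multiplicative map between Banach algebras.
   Formalization: The claim that for H_1=H_2 the identity is mapped on the identity fails for general Riesz bases (Ψ=Φ=(2e_k) gives M(id)=4·id); it is replaced by: each of M^(Φ,Ψ) and O^(Φ̃,Ψ̃) maps the identity to the identity if and only if Ψ=Φ̃. *)

(* Defs.v *)
From HB Require Import structures.
From mathcomp Require Import all_boot all_order all_algebra finmap.
From mathcomp Require Import complex.
From mathcomp Require Import all_classical all_reals all_analysis.
From mathcomp.analysis.showcase Require summability.

Set Implicit Arguments.
Unset Strict Implicit.
Unset Printing Implicit Defensive.

Import Order.TTheory GRing.Theory Num.Theory.
Import numFieldNormedType.Exports.

Local Open Scope classical_set_scope.
Local Open Scope ring_scope.
Local Open Scope complex_scope.

(* [{dot H for Num.conj}] is linear in its first argument and conjugate-linear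
   in its second one. *)
HB.mixin Record NormedModule_isHilbert (R : realType) H
    of CompleteNormedModule R[i] H := {
  inner : {dot H for (@Num.conj R[i])} ;
  inner_normE : forall x : H, inner x x = `|x| ^+ 2
}.

#[short(type="hilbertType")]
HB.structure Definition Hilbert (R : realType) :=
  {H of CompleteNormedModule R[i] H & NormedModule_isHilbert R H}.

Section Defs.
Variables (R : realType) (K : countType).
Local Notation C := (R[i]).

Definition infinite_dimensional (V : lmodType C) : Prop :=
  forall (n : nat) (e : 'I_n -> V),
    exists x : V, forall a : 'I_n -> C, x <> \sum_i a i *: e i.

(* Series indexed by [K] are limits of the net of finite partial sums, so no
   enumeration of [K] is chosen. [usum] is unspecified on divergent series. *)
Definition usummable (V : normedModType C) (x : K -> V) : Prop :=
  cvg (summability.partial_sum x @ summability.totally).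

Definition usum (V : normedModType C) (x : K -> V) : V := summability.sum x.

Definition l2sqnorm (c : K -> C) : \bar R :=
  \esum_(k in [set: K]) (ComplexField.Normc.normc (c k) ^+ 2)%:E.

Definition l2 : set (K -> C) := [set c | (l2sqnorm c < +oo)%E].

(* [C^o] carries the module and normed structures of [C] over itself. *)
Definition infmx : Type := K -> K -> C^o.
HB.instance Definition _ := GRing.Lmodule.on infmx.

Definition mxapp (M : infmx) (c : K -> C) : K -> C :=
  fun j => usum (fun k => (M j k * c k : C^o)).

(* Bounded operators on l^2 are identified with their matrices; the norm
   estimate, between squared norms, forces [M c] to lie in l^2. *)
Definition bounded_mx : set infmx :=
  [set M | exists B : R, forall c, l2 c ->
     (forall j, usummable (fun k => (M j k * c k : C^o))) /\
     (l2sqnorm (mxapp M c) <= (B ^+ 2)%:E * l2sqnorm c)%E].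

Definition mxprod (M N : infmx) : infmx :=
  fun j l => usum (fun k => (M j k * N k l : C^o)).

Definition mxid : infmx := fun j k => (j == k)%:R.

Definition bounded_op (V W : normedModType C) : set (V -> W) :=
  [set O | linear O /\ exists B : R, forall x, `|O x| <= B%:C * `|x|].

Definition complete_seq (V : normedModType C) (psi : K -> V) : Prop :=
  closure [set x | exists (J : {fset K}) (c : K -> C),
                     x = \sum_(k <- J) c k *: psi k] = [set: V].

Definition riesz_basis (V : normedModType C) (psi : K -> V) : Prop :=
  complete_seq psi /\
  exists A B : R, [/\ 0 < A, 0 < B &
    forall (J : {fset K}) (c : K -> C),
      A%:C * (\sum_(k <- J) `|c k| ^+ 2)
        <= `|\sum_(k <- J) c k *: psi k| ^+ 2
        <= B%:C * (\sum_(k <- J) `|c k| ^+ 2)].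

Definition frame_op (H : hilbertType R) (psi : K -> H) : H -> H :=
  fun f => usum (fun k => inner f (psi k) *: psi k).

(* The frame operator of a frame is bijective; its inverse is taken with the
   total function ['pinv_], whose default value is then irrelevant. *)
Definition canonical_dual (H : hilbertType R) (psi : K -> H) : K -> H :=
  fun k => 'pinv_(fun=> 0) [set: H] (frame_op psi) (psi k).

Definition mx_of_op (H1 H2 : hilbertType R) (phi : K -> H2) (psi : K -> H1)
    (O : H1 -> H2) : infmx :=
  fun m n => inner (O (psi n)) (phi m).

Definition op_of_mx (H1 H2 : hilbertType R) (phi : K -> H2) (psi : K -> H1)
    (M : infmx) : H1 -> H2 :=
  fun h => usum (fun k => usum (fun j => (M k j * inner h (psi j) : C^o)) *: phi k).

(* B(X, Y) and the bounded matrices are subsets of function spaces, so an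
   algebra is given here by a module, a carrier in it and a product. *)
Definition algebra_iso (V W : lmodType C) (A : set V) (mulA : V -> V -> V)
    (B : set W) (mulB : W -> W -> W) (f : V -> W) : Prop :=
  [/\ set_bij A B f,
      forall (a : C) x y, A x -> A y -> f (a *: x + y) = a *: f x + f y
    & forall x y, A x -> A y -> f (mulA x y) = mulB (f x) (f y)].

End Defs.

Arguments bounded_mx {R K}.
Arguments mxprod {R K}.
Arguments mxid {R K}.
Arguments bounded_op {R} V W.

(* Main.v *)
Require Import Defs.
From HB Require Import structures.
From mathcomp Require Import all_boot all_order all_algebra finmap.
From mathcomp Require Import complex.
From mathcomp Require Import all_classical all_reals all_analysis.
From mathcomp Require Import ring lra.

Set Implicit Arguments.
Unset Strict Implicit.
Unset Printing Implicit Defensive.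

Import Order.TTheory GRing.Theory Num.Theory.
Import numFieldNormedType.Exports.

Local Open Scope classical_set_scope.
Local Open Scope ring_scope.

(* For a Riesz basis [psi], projecting [psi k] off the span of the other
   vectors gives a biorthogonal sequence [psi']; the lower Riesz bound [A] gives [psi'] the
   upper bound [A^-1]. Hence [f = \sum_k <f, psi'_k> psi_k] and
   [f = \sum_k <f, psi_k> psi'_k] by density, and [psi'] is the canonical dual
   because [S psi'_k = psi_k] for the frame operator [S], which is injective.
   The pair is thus symmetric in [psi] and [psi'], and everything in the theorem
   follows by pushing bounded operators through these two expansions: the
   multiplicativity and the identities for [O] are transported from those of its
   inverse matrix map. *)

(** * Real-valued norms on complex spaces *)

Section RealNorm.
Variables (R : realType) (V : normedModType R[i]).
Implicit Types x y : V.

(** Norms of [R[i]]-modules take values in [R[i]], which is only partially ordered; the real part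
    makes real arithmetic available. *)
Definition rnorm x : R := complex.Re `|x|.

Lemma rnormE x : `|x| = (rnorm x)%:C%C.
Proof. by rewrite /rnorm RRe_real// ger0_real. Qed.

Lemma rnorm_ge0 x : 0 <= rnorm x.
Proof. by rewrite -ler0c -rnormE. Qed.

Lemma rnorm0 : rnorm (0 : V) = 0.
Proof. by rewrite /rnorm normr0. Qed.

Lemma rnorm0_eq0 x : rnorm x = 0 -> x = 0.
Proof. by move=> h; apply/eqP; rewrite -normr_eq0 rnormE h. Qed.

Lemma rnormN x : rnorm (- x) = rnorm x.
Proof. by rewrite /rnorm normrN. Qed.

Lemma rnormD x y : rnorm (x + y) <= rnorm x + rnorm y.
Proof. by rewrite -lecR rmorphD /= -!rnormE ler_normD. Qed.

Lemma rnorm_distC x y : rnorm (x - y) = rnorm (y - x).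
Proof. by rewrite -rnormN opprB. Qed.

Lemma rnorm_small_eq0 x (b : R) :
  (forall e : R, 0 < e -> rnorm x <= e * b) -> x = 0.
Proof.
move=> h; apply: rnorm0_eq0; apply/eqP; rewrite eq_le rnorm_ge0 andbT.
rewrite leNgt; apply/negP => xgt0.
(* This choice of [e] makes [e * b] smaller than [rnorm x / 2]; the [+ 1] keeps the divisor positive
   when [b = 0]. *)
have := h (rnorm x / (2 * (`|b| + 1))).
have b1 : 0 < `|b| + 1 by rewrite ltr_wpDl.
rewrite divr_gt0// ?mulr_gt0// => /(_ isT); apply/negP; rewrite -ltNge.
rewrite mulrAC ltr_pdivrMr ?mulr_gt0// ltr_pM2l//.
by rewrite (le_lt_trans (ler_norm b))//; lra.
Qed.

End RealNorm.

Lemma rnormZ (R : realType) (V : normedModType R[i]) (a : R[i]) (x : V) :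
  rnorm (a *: x) = rnorm (a : R[i]^o) * rnorm x.
Proof. by apply: complexI; rewrite rmorphM /= -!rnormE normrZ. Qed.

Lemma rnormM (R : realType) (a b : R[i]) :
  rnorm (a * b : R[i]^o) = rnorm (a : R[i]^o) * rnorm (b : R[i]^o).
Proof. exact: rnormZ. Qed.

Lemma rnorm_real (R : realType) (a : R) : 0 <= a -> rnorm (a%:C%C : R[i]^o) = a.
Proof. by move=> a0; rewrite /rnorm ger0_norm// ler0c. Qed.

(** * Inner products and the Cauchy-Schwarz inequality *)

Section Inner.
Variables (R : realType) (H : hilbertType R).
Implicit Types (x y z : H) (a : R[i]).

Lemma innerDl x y z : inner (x + y) z = inner x z + inner y z.
Proof. exact: linearDl. Qed.

Lemma innerBl x y z : inner (x - y) z = inner x z - inner y z.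
Proof. exact: linearBl. Qed.

Lemma innerDr x y z : inner z (x + y) = inner z x + inner z y.
Proof. exact: linearDr. Qed.

Lemma innerBr x y z : inner z (x - y) = inner z x - inner z y.
Proof. exact: linearBr. Qed.

Lemma innerZl a x z : inner (a *: x) z = a * inner x z.
Proof. exact: linearZl_LR. Qed.

Lemma innerZr a x z : inner z (a *: x) = (a^*)%C * inner z x.
Proof. exact: linearZr_LR. Qed.

Lemma innerC x y : inner x y = ((inner y x)^*)%C.
Proof. by rewrite hermC expr0 mul1r. Qed.

Lemma inner0r x : inner x 0 = 0. Proof. exact: linear0r. Qed.

Lemma inner_suml (I : Type) (r : seq I) (F : I -> H) z :
  inner (\sum_(i <- r) F i) z = \sum_(i <- r) inner (F i) z.
Proof. exact: linear_sumlz. Qed.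

Lemma inner_sumr (I : Type) (r : seq I) (F : I -> H) z :
  inner z (\sum_(i <- r) F i) = \sum_(i <- r) inner z (F i).
Proof. exact: linear_sumr. Qed.

Lemma inner_rnorm x : inner x x = (rnorm x ^+ 2)%:C%C.
Proof. by rewrite inner_normE rnormE rmorphXn. Qed.

Lemma parallelogram x y :
  rnorm (x + y) ^+ 2 + rnorm (x - y) ^+ 2
  = (rnorm x ^+ 2 + rnorm y ^+ 2) + (rnorm x ^+ 2 + rnorm y ^+ 2).
Proof.
apply: complexI; rewrite !rmorphD /= -!inner_rnorm.
by rewrite innerBl !innerBr innerDl !innerDr; ring.
Qed.

(** Pythagoras for the projection of [x] on the line of [y], cleared of its denominator. It yields
    both Cauchy-Schwarz and the orthogonality of nearest-point residuals. *)
Lemma rnorm_subZ_sqr x y : y != 0 ->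
  rnorm (x - (inner x y / inner y y) *: y) ^+ 2 * rnorm y ^+ 2
  = rnorm x ^+ 2 * rnorm y ^+ 2 - rnorm (inner x y : R[i]^o) ^+ 2.
Proof.
move=> y0; apply: complexI; rewrite rmorphB /= (rmorphM _ (rnorm (x - _) ^+ 2)).
rewrite (rmorphM _ (rnorm x ^+ 2)) /= -!inner_rnorm rmorphXn /= -rnormE sqr_normc.
have n0 : inner y y != 0 by rewrite inner_normE expf_neq0// normr_eq0.
rewrite !(innerBl, innerBr, innerZl, innerZr) (innerC y x) rmorphM fmorphV /=.
rewrite -(innerC y y); field.
exact: n0.
Qed.

Lemma cauchy_schwarz x y : rnorm (inner x y : R[i]^o) <= rnorm x * rnorm y.
Proof.
have [->|y0] := eqVneq y 0; first by rewrite inner0r !rnorm0 mulr0.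
rewrite -(@ler_pXn2r _ 2) ?nnegrE ?mulr_ge0 ?rnorm_ge0//.
by rewrite exprMn -subr_ge0 -rnorm_subZ_sqr// mulr_ge0// exprn_ge0// rnorm_ge0.
Qed.

End Inner.

(** * Convergence and orthogonal projection *)

Section Convergence.
Variable R : realType.

Lemma gt0_complexP (e : R[i]) : 0 < e -> exists2 r : R, 0 < r & e = r%:C%C.
Proof.
move=> e0; exists (complex.Re e); last by rewrite RRe_real// gtr0_real.
by move: e0; rewrite ltcE => /andP[].
Qed.

Lemma cvg_rnormP (V : normedModType R[i]) (T : Type) (F : set_system T)
    (FF : Filter F) (f : T -> V) (l : V) :
  f @ F --> l <-> forall e : R, 0 < e -> \forall t \near F, rnorm (l - f t) < e.
Proof.
split=> [/cvgrPdist_lt h e e0|h].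
  have := h e%:C%C; rewrite ltcR => /(_ e0); apply: filterS => t.
  by rewrite rnormE ltcR.
apply/cvgrPdist_lt => _ /gt0_complexP[e e0 ->].
by apply: filterS (h e e0) => t; rewrite rnormE ltcR.
Qed.

Lemma cauchy_cvg_rnorm (V : completeNormedModType R[i]) (T : Type)
    (F : set_system T) (FF : ProperFilter F) (f : T -> V) :
  (forall e : R, 0 < e -> exists x, \forall t \near F, rnorm (x - f t) < e) ->
  cvg (f @ F).
Proof.
move=> h; apply: cauchy_cvg; apply: cauchy_exP => _ /gt0_complexP[e e0 ->].
have [x hx] := h e e0; exists x; apply: filterS hx => t /=.
by rewrite -ball_normE /= rnormE ltcR.
Qed.

End Convergence.

(* The minimizing sequence of the distance from [x] to [W] is Cauchy by the
   parallelogram law; its limit is the component of [x] orthogonal to [W]. *)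
Lemma orthogonal_component (R : realType) (H : hilbertType R) (W : set H) (x : H) :
  W 0 -> (forall (a : R[i]) u w, W u -> W w -> W (a *: u + w)) ->
  exists v, (forall w, W w -> inner v w = 0) /\
    forall e : R, 0 < e -> exists2 w, W w & rnorm (v - (x - w)) < e.
Proof.
move=> W0 WZD.
pose E := [set rnorm (x - w) ^+ 2 | w in W].
have E0 : E !=set0 by exists (rnorm (x - 0) ^+ 2), 0.
have lE : has_lbound E by exists 0 => _ [w _ <-]; exact: exprn_ge0 (rnorm_ge0 _).
pose d := inf E.
have ld w : W w -> d <= rnorm (x - w) ^+ 2 by move=> Ww; apply: ge_inf => //; exists w.
have /choice[w hw] (n : nat) :
    exists w, W w /\ rnorm (x - w) ^+ 2 < d + n.+1%:R^-1.
  have n0 : 0 < (n.+1%:R^-1 : R) by rewrite invr_gt0.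
  have [_ [w Ww <-] h] := inf_adherent n0 (conj E0 lE).
  by exists w.
have dist n w' : W w' ->
    rnorm ((x - w n) - (x - w')) ^+ 2
      <= 2 * rnorm (x - w n) ^+ 2 + 2 * rnorm (x - w') ^+ 2 - 4 * d.
  move=> Ww'.
  have Wh : W (2^-1 *: (w n + w')).
    have := WZD 2^-1 (w n + w') 0; rewrite addr0; apply=> //.
    by have := WZD 1 (w n) w' (hw n).1 Ww'; rewrite scale1r.
  have := parallelogram (x - w n) (x - w').
  have -> : x - w n + (x - w') = 2%:R *: (x - 2^-1 *: (w n + w')).
    rewrite scalerBr scalerA mulfV ?pnatr_eq0// scale1r scaler_nat mulr2n.
    by rewrite addrACA opprD.
  rewrite rnormZ (_ : rnorm (2%:R : R[i]^o) = 2); last first.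
    by rewrite -(rnorm_real (ler0n R 2)) rmorph_nat.
  by rewrite exprMn; have := ld _ Wh; nra.
have near_inv (e : R) (e0 : 0 < e) : \forall n \near \oo, n.+1%:R^-1 < e :=
  near_infty_natSinv_lt (PosNum e0).
have cv : cvg ((fun n => x - w n) @ \oo).
  apply: cauchy_cvg_rnorm => e e0.
  (* By [dist] the squared distance between terms [n] and [N] is below
     [2 / (n + 1) + 2 / (N + 1)]. *)
  have e4 : 0 < e ^+ 2 / 4 by rewrite divr_gt0// exprn_gt0.
  have [N hN] := filter_ex (near_inv _ e4).
  exists (x - w N); apply: filterS (near_inv _ e4) => n hn.
  rewrite -(@ltr_pXn2r _ 2) ?nnegrE ?rnorm_ge0 ?(ltW e0)//.
  move: hn hN (dist N _ (hw n).1) (hw n).2 (hw N).2 => /=.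
  by move: (n.+1%:R^-1) (N.+1%:R^-1) => a b; lra.
pose v := lim ((fun n => x - w n) @ \oo); exists v.
have /cvg_rnormP cvv : (fun n => x - w n) @ \oo --> v by [].
split=> [u Wu|e e0]; last first.
  by have [n hn] := filter_ex (cvv e e0); exists (w n) => //; exact: (hw n).1.
have [->|u0] := eqVneq u 0; first exact: inner0r.
apply: (@rnorm_small_eq0 _ _ (inner v u : R[i]^o) (rnorm u + rnorm u)) => e e0.
have e2 : 0 < e ^+ 2 by rewrite exprn_gt0.
have [n [hn1 hn2]] := filter_ex (filterI (near_inv _ e2) (cvv e e0)).
(* Subtracting from [x - w n] its projection on [u] stays in [x - W], so the squared norm remains at
   least [d]. It therefore drops by less than [1 / (n + 1)], and by [rnorm_subZ_sqr] this drop
   controls the inner product with [u]. *)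
have hvn : rnorm (inner (x - w n) u : R[i]^o) <= e * rnorm u.
  rewrite -(@ler_pXn2r _ 2) ?nnegrE ?mulr_ge0 ?rnorm_ge0 ?(ltW e0)//.
  have Wn : W ((inner (x - w n) u / inner u u) *: u + w n) by apply: WZD => //; exact: (hw n).1.
  have := rnorm_subZ_sqr (x - w n) u0.
  rewrite -addrA -opprD [w n + _]addrC.
  move/eqP; rewrite eq_sym subr_eq [X in _ == X]addrC -subr_eq => /eqP <-.
  rewrite -mulrBl exprMn ler_wpM2r ?sqr_ge0//.
  move: (ld _ Wn) (hw n).2 hn1 => /=; move: (n.+1%:R^-1) => a; lra.
have -> : inner v u = inner (x - w n) u + inner (v - (x - w n)) u.
  by rewrite -innerDl [x - w n + _]addrC subrK.
rewrite (le_trans (rnormD _ _))// mulrDr lerD//.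
by rewrite (le_trans (cauchy_schwarz _ _))// ler_wpM2r ?rnorm_ge0// ltW.
Qed.

(* Unconditional sums *)
#[local] Existing Instance summability.totally_filter.

Section UnconditionalSums.
Variables (R : realType) (K : countType).
Local Notation C := R[i].

(** Convergence of the net of finite sums in epsilon form. Being a relation, it gives summability
    and the value of [usum] together. *)
Definition has_usum (V : normedModType C) (x : K -> V) (s : V) : Prop :=
  forall e : R, 0 < e -> exists J0 : {fset K},
    forall J : {fset K}, (J0 `<=` J)%fset -> rnorm (s - \sum_(k <- J) x k) < e.

Lemma has_usumP (V : normedModType C) (x : K -> V) (s : V) :
  has_usum x s <-> summability.partial_sum x @ summability.totally --> s.
Proof.
rewrite cvg_rnormP; split=> h e /(h e) {h}.
  move=> [J0 h]; exists J0 => // J /h; rewrite /summability.partial_sum.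
  by rewrite big_seq_fsetE.
move=> [J0 _ h]; exists J0 => J /h; rewrite /= /summability.partial_sum.
by rewrite big_seq_fsetE.
Qed.

Lemma usum_has (V : normedModType C) (x : K -> V) :
  usummable x -> has_usum x (usum x).
Proof. by move=> h; apply/has_usumP. Qed.

Lemma has_usum_summable (V : normedModType C) (x : K -> V) s :
  has_usum x s -> usummable x.
Proof. by move/has_usumP => h; apply/cvg_ex; exists s. Qed.

Lemma has_usumE (V : normedModType C) (x : K -> V) s :
  has_usum x s -> usum x = s.
Proof. by move/has_usumP => h; apply: cvg_lim => //; exact: norm_hausdorff. Qed.

Lemma has_usum_ZD (V : normedModType C) (a : C) (x y : K -> V) s t :
  has_usum x s -> has_usum y t ->
  has_usum (fun k => a *: x k + y k) (a *: s + t).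
Proof.
move=> hx hy e e0.
have a0 : 0 < rnorm (a : C^o) + 1 by rewrite ltr_wpDl ?rnorm_ge0.
have [|J1 h1] := hx (e / 2 / (rnorm (a : C^o) + 1)); first by rewrite !divr_gt0.
have [|J2 h2] := hy (e / 2); first by rewrite divr_gt0.
exists (J1 `|` J2)%fset => J; rewrite fsubUset => /andP[/h1 {}h1 /h2 {}h2].
rewrite big_split/= -scaler_sumr opprD addrACA -scalerBr.
rewrite (le_lt_trans (rnormD _ _))// rnormZ.
move: h1; rewrite ltr_pdivlMr// => h1; have := rnorm_ge0 (s - \sum_(k <- J) x k).
move: h2; nra.
Qed.

Lemma has_usum_fin (V : normedModType C) (x : K -> V) (J : {fset K}) :
  (forall k, k \notin J -> x k = 0) -> has_usum x (\sum_(k <- J) x k).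
Proof.
move=> xJ e e0; exists J => J' JJ'.
by rewrite (big_fset_incl _ JJ') ?subrr ?rnorm0// => k _; exact: xJ.
Qed.

Lemma has_usum_le (V : normedModType C) (x : K -> V) s (M : R) :
  has_usum x s -> (forall J : {fset K}, rnorm (\sum_(k <- J) x k) <= M) ->
  rnorm s <= M.
Proof.
move=> hx hM; apply/ler_addgt0Pr => e e0; have [J h] := hx e e0.
have := rnormD (s - \sum_(k <- J) x k) (\sum_(k <- J) x k); rewrite subrK.
by have := h J (fsubset_refl J); have := hM J; lra.
Qed.

End UnconditionalSums.

(** * Bounded operators and dense sets *)

Section BoundedOperators.
Variable R : realType.
Local Notation C := R[i].
Variables (V W : normedModType C) (T : V -> W).
Hypothesis bT : bounded_op V W T.

Lemma bounded_op_rnorm : exists2 B : R, 0 <= B & forall x, rnorm (T x) <= B * rnorm x.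
Proof.
have [_ [B hB]] := bT; exists `|B| => // x.
have := hB x; rewrite !rnormE -rmorphM lecR => /le_trans; apply.
by rewrite ler_wpM2r ?rnorm_ge0// ler_norm.
Qed.

Lemma bounded_op_linear (a : C) u v : T (a *: u + v) = a *: T u + T v.
Proof. exact: bT.1. Qed.

Lemma bounded_op0 : T 0 = 0.
Proof. by have := bounded_op_linear (-1) 0 0; rewrite scaler0 addr0 scaleN1r addNr. Qed.

Lemma bounded_opD u v : T (u + v) = T u + T v.
Proof. by have := bounded_op_linear 1 u v; rewrite !scale1r. Qed.

Lemma bounded_opZ (a : C) u : T (a *: u) = a *: T u.
Proof. by have := bounded_op_linear a u 0; rewrite bounded_op0 !addr0. Qed.

Lemma bounded_opB u v : T (u - v) = T u - T v.
Proof. by rewrite bounded_opD -scaleN1r bounded_opZ scaleN1r. Qed.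

Lemma bounded_op_sum (I : Type) (r : seq I) (F : I -> V) :
  T (\sum_(i <- r) F i) = \sum_(i <- r) T (F i).
Proof. exact: (big_morph T bounded_opD bounded_op0). Qed.

Lemma has_usum_bounded_op (K : countType) (x : K -> V) s :
  has_usum x s -> has_usum (T \o x) (T s).
Proof.
have [B B0 hB] := bounded_op_rnorm.
move=> hx e e0; have B1 : 0 < B + 1 by rewrite ltr_wpDl.
have [|J0 h] := hx (e / (B + 1)); first by rewrite divr_gt0.
exists J0 => J /h; rewrite ltr_pdivlMr// => {}h.
rewrite -bounded_op_sum -bounded_opB (le_lt_trans (hB _))//.
by have := rnorm_ge0 (s - \sum_(k <- J) x k); nra.
Qed.

(** Boundedness provides some constant [M]; density carries the sharper [B] from [S] to all of [V].
    For [y] in [S] near [x], [rnorm (T x)] is at most [(M + B) * rnorm (x - y) + B * rnorm x]. *)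
Lemma dense_bounded_op (S : set V) (B : R) : closure S = setT -> 0 <= B ->
  (forall x, S x -> rnorm (T x) <= B * rnorm x) ->
  forall x, rnorm (T x) <= B * rnorm x.
Proof.
move=> dS B0 hS x; have [M M0 hM] := bounded_op_rnorm.
apply/ler_addgt0Pr => e e0.
have BM : 0 < B + M + 1 by rewrite ltr_wpDl// addr_ge0.
have : closure S x by rewrite dS.
move=> /(_ (ball x (e / (B + M + 1))%:C%C)) [|y [Sy]].
  by apply: nbhsx_ballx; rewrite ltcR divr_gt0.
rewrite -ball_normE /= rnormE ltcR ltr_pdivlMr// => hy.
have := hS y Sy; have := hM (x - y); rewrite bounded_opB => h1 h2.
have h3 := rnormD (T x - T y) (T y); rewrite subrK in h3.
have h4 := rnormD (y - x) x; rewrite subrK rnorm_distC in h4.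
have := ler_wpM2l B0 h4; have := rnorm_ge0 (x - y); nra.
Qed.

End BoundedOperators.

Lemma inner_bounded_op (R : realType) (H : hilbertType R) (z : H) :
  bounded_op H R[i]^o (fun x => inner x z).
Proof.
split=> [a u v|]; first by rewrite innerDl innerZl.
exists (rnorm z) => x; rewrite !rnormE -rmorphM lecR mulrC.
exact: cauchy_schwarz.
Qed.

Lemma bounded_op_bound (R : realType) (V W : normedModType R[i]) (T : V -> W) (B : R) :
  (forall (a : R[i]) u v, T (a *: u + v) = a *: T u + T v) ->
  (forall x, rnorm (T x) <= B * rnorm x) -> bounded_op V W T.
Proof.
move=> lT hB; split; first exact: lT.
by exists B => x; rewrite !rnormE -rmorphM lecR.
Qed.

Lemma bounded_op_ZD (R : realType) (V W : normedModType R[i]) (a : R[i])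
    (T U : V -> W) :
  bounded_op V W T -> bounded_op V W U ->
  bounded_op V W (fun x => a *: T x + U x).
Proof.
move=> bT bU; have [B B0 hB] := bounded_op_rnorm bT.
have [B' B'0 hB'] := bounded_op_rnorm bU.
apply: (@bounded_op_bound _ _ _ _ (rnorm (a : R[i]^o) * B + B')) => [c u v|x].
  rewrite (bounded_op_linear bT) (bounded_op_linear bU) !scalerDr !scalerA.
  by rewrite [a * c]mulrC addrACA.
rewrite (le_trans (rnormD _ _))// rnormZ mulrDl -mulrA lerD//.
by rewrite ler_wpM2l ?rnorm_ge0.
Qed.

Lemma bounded_op_comp (R : realType) (U V W : normedModType R[i])
    (T : V -> W) (T' : U -> V) :
  bounded_op V W T -> bounded_op U V T' -> bounded_op U W (T \o T').
Proof.
move=> bT bT'; have [B B0 hB] := bounded_op_rnorm bT.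
have [B' B'0 hB'] := bounded_op_rnorm bT'.
apply: (@bounded_op_bound _ _ _ _ (B * B')) => [c u v|x] /=.
  by rewrite (bounded_op_linear bT') (bounded_op_linear bT).
by rewrite (le_trans (hB _))// -mulrA ler_wpM2l.
Qed.

Lemma bounded_op_id (R : realType) (V : normedModType R[i]) : bounded_op V V id.
Proof. by apply: (@bounded_op_bound _ _ _ _ 1) => // x; rewrite mul1r. Qed.

(** The difference of the operators satisfies the bound [0] on [S], which [dense_bounded_op]
    extends. *)
Lemma eq_bounded_op (R : realType) (V W : normedModType R[i]) (T U : V -> W)
    (S : set V) :
  bounded_op V W T -> bounded_op V W U -> closure S = setT ->
  (forall x, S x -> T x = U x) -> T = U.
Proof.
move=> bT bU dS hS; apply/funext => x; apply/eqP.
rewrite -subr_eq0 -addrC -scaleN1r; apply/eqP/rnorm0_eq0.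
apply/eqP; rewrite eq_le rnorm_ge0 andbT -[0](mul0r (rnorm x)).
apply: (dense_bounded_op (bounded_op_ZD (-1) bU bT) dS (lexx 0)) => y Sy.
by rewrite hS// scaleN1r addNr rnorm0 mul0r.
Qed.

(** * Square-summable families, synthesis and Bessel's inequality *)

Lemma big_fset_subD (V : nmodType) (K : choiceType) (J0 J : {fset K}) (F : K -> V) :
  (J0 `<=` J)%fset ->
  \sum_(k <- J) F k = \sum_(k <- J0) F k + \sum_(k <- (J `\` J0)%fset) F k.
Proof.
move=> J0J; rewrite (big_fsetID _ (mem J0) J) /=; congr (_ + _).
  congr (\sum_(k <- enum_fset _) _); apply/fsetP => k; rewrite !inE /=.
  by apply/andP/idP => [[]//|kJ0]; split=> //; exact: (fsubsetP J0J).
by congr (\sum_(k <- enum_fset _) _); apply/fsetP => k; rewrite !inE /= andbC.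
Qed.

Section SquareSummable.
Variables (R : realType) (K : countType).
Local Notation C := R[i].
Implicit Types (c : K -> C) (J : {fset K}).

Definition sqsum c J : R := \sum_(k <- J) rnorm (c k : C^o) ^+ 2.

Lemma sqsum_ge0 c J : 0 <= sqsum c J.
Proof. by apply: sumr_ge0 => k _; exact: sqr_ge0. Qed.

Lemma l2sqnormE c : l2sqnorm c = ereal_sup (range (fun J => (sqsum c J)%:E)).
Proof.
rewrite /l2sqnorm /esum; congr ereal_sup; apply/seteqP; split=> y /=.
  move=> [A [finA _] <-]; have /finite_fsetP[J ->] := finA; exists J => //.
  by rewrite -fsbig_seq// /sqsum -sumEFin.
move=> [J _ <-]; exists [set` J]; first by split=> //; exact: finite_fset.
by rewrite -fsbig_seq// /sqsum -sumEFin.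
Qed.

(** Lets later estimates run on finite real sums instead of extended reals. *)
Lemma l2sqnorm_leP c (b : R) : (l2sqnorm c <= b%:E)%E <-> forall J, sqsum c J <= b.
Proof.
rewrite l2sqnormE; split=> [h J|h].
  by rewrite -lee_fin (le_trans _ h)//; apply: ereal_sup_ubound; exists J.
by apply/ereal_supP => _ [J _ <-]; rewrite lee_fin.
Qed.

Lemma l2_leP c (b : R) : (forall J, sqsum c J <= b) -> l2 c.
Proof. by move=> /l2sqnorm_leP h; rewrite /l2 /= (le_lt_trans h)// ltry. Qed.

Lemma l2sqnorm_fin c : l2 c -> exists2 s : R, 0 <= s & l2sqnorm c = s%:E.
Proof.
move=> hc; have h0 : (0 <= l2sqnorm c)%E.
  by apply: esum_ge0 => k _; rewrite lee_fin sqr_ge0.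
exists (fine (l2sqnorm c)); first exact: fine_ge0.
by rewrite fineK// ge0_fin_numE.
Qed.

(** Once the sum over [J0] is within [e] of the supremum, less than [e] is left for indices outside
    [J0]. *)
Lemma sqsum_tail c : l2 c -> forall e : R, 0 < e ->
  exists J0, forall J, (J0 `<=` J)%fset -> sqsum c (J `\` J0)%fset < e.
Proof.
move=> hc e e0; have [s s0 hs] := l2sqnorm_fin hc.
have := hs; rewrite l2sqnormE => hsup.
have : (s%:E - e%:E < ereal_sup (range (fun J => (sqsum c J)%:E)))%E.
  by rewrite hsup -EFinB lte_fin ltrBlDr ltrDl.
move=> /ereal_sup_gtP[_ [J0 _ <-]]; rewrite -EFinB lte_fin => hJ0.
exists J0 => J J0J; have /l2sqnorm_leP/(_ J) : (l2sqnorm c <= s%:E)%E by rewrite hs.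
rewrite {1}/sqsum (big_fset_subD _ J0J) -/(sqsum c J0) -/(sqsum c _); lra.
Qed.

(** The Bessel condition in synthesis form. It makes series with [l2] coefficients converge, and
    [bessel] recovers the bound on inner products from it with the same constant. *)
Definition riesz_upper (V : normedModType C) (psi : K -> V) (B : R) : Prop :=
  0 <= B /\ forall J c, rnorm (\sum_(k <- J) c k *: psi k) ^+ 2 <= B * sqsum c J.

(** The net of partial sums is Cauchy: beyond [J0], the upper bound controls the difference by a
    tail of [c]. *)
Lemma synthesis_has_usum (V : completeNormedModType C) (psi : K -> V) B c :
  riesz_upper psi B -> l2 c ->
  has_usum (fun k => c k *: psi k) (usum (fun k => c k *: psi k)).
Proof.
move=> [B0 hB] hc; apply: usum_has.
apply: cauchy_cvg_rnorm => e e0.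
have B1 : 0 < B + 1 by rewrite ltr_wpDl.
have [|J0 hJ0] := sqsum_tail hc (e := e ^+ 2 / (B + 1)).
  by rewrite divr_gt0// exprn_gt0.
exists (\sum_(k <- J0) c k *: psi k); exists J0 => // J J0J.
rewrite /= /summability.partial_sum.
rewrite -(big_seq_fsetE _ J predT (fun k => c k *: psi k)) rnorm_distC.
rewrite (big_fset_subD _ J0J) addrC addKr.
move: (hJ0 J J0J); set J1 := (J `\` J0)%fset.
rewrite ltr_pdivlMr// => h1.
rewrite -(@ltr_pXn2r _ 2) ?nnegrE ?rnorm_ge0 ?(ltW e0)//.
by have := hB J1 c; have := sqsum_ge0 c J1; nra.
Qed.

Lemma rnorm_synthesis_le (V : completeNormedModType C) (psi : K -> V) B c (s : R) :
  riesz_upper psi B -> (forall J, sqsum c J <= s) ->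
  rnorm (usum (fun k => c k *: psi k)) ^+ 2 <= B * s.
Proof.
move=> uB hc; have Bs : 0 <= B * s.
  by rewrite mulr_ge0 ?uB.1// (le_trans (sqsum_ge0 c fset0)).
rewrite -(sqr_sqrtr Bs) ler_pXn2r ?nnegrE ?rnorm_ge0 ?sqrtr_ge0//.
apply: has_usum_le (synthesis_has_usum uB (l2_leP hc)) _ => J.
rewrite -(@ler_pXn2r _ 2) ?nnegrE ?rnorm_ge0 ?sqrtr_ge0// sqr_sqrtr//.
by rewrite (le_trans (uB.2 J c))// ler_wpM2l// uB.1.
Qed.

End SquareSummable.

Section Bessel.
Variables (R : realType) (K : countType) (H : hilbertType R).
Local Notation C := R[i].
Variables (psi : K -> H) (B : R).
Hypothesis uB : riesz_upper psi B.

(* Duality: [\sum_J |<f, psi_k>|^2] is the inner product of [f] with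
   [\sum_J <f, psi_k> psi_k]. *)
Lemma bessel f (J : {fset K}) :
  sqsum (fun k => inner f (psi k)) J <= B * rnorm f ^+ 2.
Proof.
set c := fun k => inner f (psi k); set S := sqsum c J.
pose g := \sum_(k <- J) c k *: psi k.
have gS : inner f g = S%:C%C.
  rewrite /g inner_sumr /S /sqsum rmorph_sum; apply: eq_bigr => k _.
  by rewrite innerZr mulrC rmorphXn /= -rnormE sqr_normc.
have := cauchy_schwarz f g; rewrite gS rnorm_real ?sqsum_ge0// => h.
have S0 : 0 <= S := sqsum_ge0 c J.
have hg : rnorm g ^+ 2 <= B * S := uB.2 J c.
(* The inequalities [S <= rnorm f * rnorm g] and [rnorm g ^+ 2 <= B * S] give the claim after
   division by [S]. *)
have [->|Sn0] := eqVneq S 0; first by rewrite mulr_ge0 ?sqr_ge0 ?uB.1.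
have {Sn0 S0} S0 : 0 < S by rewrite lt_def Sn0.
rewrite -(ler_pM2r S0).
have : S ^+ 2 <= (rnorm f * rnorm g) ^+ 2.
  by rewrite ler_pXn2r ?nnegrE ?mulr_ge0 ?rnorm_ge0// ltW.
have := sqr_ge0 (rnorm f); rewrite exprMn; nra.
Qed.

Lemma l2_analysis f : l2 (fun k => inner f (psi k)).
Proof. exact: l2_leP (bessel f). Qed.

End Bessel.

(** * Riesz bases and biorthogonal sequences *)

Lemma sum_mul_le_sqrt (R : realType) (I : Type) (r : seq I) (p q : I -> R) :
  (forall i, 0 <= p i) -> (forall i, 0 <= q i) ->
  \sum_(i <- r) p i * q i
    <= Num.sqrt (\sum_(i <- r) p i ^+ 2) * Num.sqrt (\sum_(i <- r) q i ^+ 2).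
Proof.
move=> p0 q0; elim: r => [|i r IH]; first by rewrite !big_nil sqrtr0 mulr0.
rewrite !big_cons.
have sge0 (f : I -> R) : 0 <= \sum_(j <- r) f j ^+ 2 by apply: sumr_ge0 => j _; exact: sqr_ge0.
move: IH (sqr_sqrtr (sge0 p)) (sqr_sqrtr (sge0 q)).
move: (sqrtr_ge0 (\sum_(j <- r) p j ^+ 2)) (sqrtr_ge0 (\sum_(j <- r) q j ^+ 2)).
move: (Num.sqrt (\sum_(j <- r) p j ^+ 2)) (Num.sqrt (\sum_(j <- r) q j ^+ 2)) => a b a0 b0 h <- <-.
rewrite -sqrtrM ?addr_ge0 ?sqr_ge0//.
have X0 : 0 <= \sum_(j <- r) p j * q j by apply: sumr_ge0 => j _; rewrite mulr_ge0.
have pq0 : 0 <= p i * q i by rewrite mulr_ge0.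
rewrite -[leLHS]ger0_norm ?addr_ge0// -sqrtr_sqr ler_wsqrtr//.
apply: (@le_trans _ _ ((p i * q i + a * b) ^+ 2)).
  by rewrite ler_pXn2r ?nnegrE ?addr_ge0 ?mulr_ge0// lerD2l.
(* Lagrange's identity in dimension two: this square is the gap between the two sides. *)
by have := sqr_ge0 (p i * b - q i * a); nra.
Qed.

Section RieszBasis.
Variables (R : realType) (K : countType) (H : hilbertType R).
Local Notation C := R[i].
Implicit Types (psi : K -> H) (J : {fset K}) (c : K -> C).

Definition riesz_lower psi (A : R) : Prop :=
  0 < A /\ forall J c, A * sqsum c J <= rnorm (\sum_(k <- J) c k *: psi k) ^+ 2.

Definition biorthogonal psi psi' : Prop :=
  forall j k, inner (psi j) (psi' k) = (j == k)%:R.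

Lemma riesz_basis_bounds psi : riesz_basis psi ->
  (exists A, riesz_lower psi A) /\ (exists B, riesz_upper psi B).
Proof.
move=> [_ [A [B [A0 B0 h]]]].
have sqE J c : (sqsum c J)%:C%C = \sum_(k <- J) `|c k| ^+ 2.
  by rewrite rmorph_sum; apply: eq_bigr => k _; rewrite rmorphXn /= -rnormE.
have {}h J c : A * sqsum c J <= rnorm (\sum_(k <- J) c k *: psi k) ^+ 2
    <= B * sqsum c J.
  have := h J c; rewrite -sqE rnormE -!lecR.
  by rewrite !(rmorphM _ _ (sqsum _ _)) rmorphXn.
split; [exists A|exists B]; split=> [|J c]; rewrite ?(ltW B0)//.
  by have /andP[] := h J c.
by have /andP[] := h J c.
Qed.

(** The lower bound keeps [psi k] away from the span [W] of the other vectors, so its component [v]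
    orthogonal to [W] is nonzero; a multiple of [v] is the required vector. *)
Lemma biorthogonal_exists psi A : riesz_lower psi A ->
  exists psi', biorthogonal psi psi'.
Proof.
move=> [A0 hA]; suff /choice[psi' h] (k : K) :
    exists u, forall j, inner (psi j) u = (j == k)%:R by exists psi' => j k.
pose W := [set w | exists J c, k \notin J /\ w = \sum_(j <- J) c j *: psi j].
have W0 : W 0 by exists fset0, (fun=> 0); rewrite inE big_seq_fset0.
have widen J J' c : (J `<=` J')%fset -> \sum_(j <- J) c j *: psi j =
    \sum_(j <- J') (if j \in J then c j else 0) *: psi j.
  move=> JJ'; rewrite -(big_fset_incl _ JJ'); last first.
    by move=> j _ /negbTE ->; rewrite scale0r.
  by rewrite big_seq [RHS]big_seq; apply: eq_bigr => j ->.
have WZD (a : C) u w : W u -> W w -> W (a *: u + w).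
  move=> [J [c [kJ ->]]] [J' [c' [kJ' ->]]]; exists (J `|` J')%fset.
  exists (fun j => a * (if j \in J then c j else 0) + (if j \in J' then c' j else 0)).
  split; first by rewrite inE negb_or kJ.
  rewrite (widen J _ _ (fsubsetUl J J')) (widen J' _ _ (fsubsetUr J J')).
  rewrite scaler_sumr -big_split; apply: eq_bigr => j _ /=.
  by rewrite scalerDl scalerA.
(* [psi k - w] is a combination with coefficient [1] at [k], which alone contributes [A] to the
   lower bound. *)
have Wdist w : W w -> A <= rnorm (psi k - w) ^+ 2.
  move=> [J [c [kJ ->]]].
  pose c' j := if j == k then 1 else - c j.
  have -> : psi k - \sum_(j <- J) c j *: psi j = \sum_(j <- (k |` J)%fset) c' j *: psi j.
    rewrite big_fsetU1//= /c' eqxx scale1r -sumrN; congr (_ + _).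
    rewrite big_seq [RHS]big_seq; apply: eq_bigr => j jJ.
    by case: eqP => [jk|_]; [rewrite -jk jJ in kJ|rewrite scaleNr].
  apply: le_trans (hA _ _); rewrite ler_peMr ?(ltW A0)//.
  rewrite /sqsum big_fsetU1//= /c' eqxx.
  have -> : rnorm (1 : C^o) = 1 by rewrite /rnorm normr1.
  by rewrite expr1n lerDl sumr_ge0// => j _; exact: sqr_ge0.
have [v [vW hv]] := orthogonal_component (psi k) W0 WZD.
have v0 : inner v v != 0.
  rewrite inner_normE expf_neq0// normr_eq0; apply/eqP => v0.
  have [|w Ww] := hv (Num.sqrt A); first by rewrite sqrtr_gt0.
  rewrite v0 sub0r rnormN => hw; have := Wdist w Ww; apply/negP; rewrite -ltNge.
  by rewrite -(sqr_sqrtr (ltW A0)) ltr_pXn2r// nnegrE ?rnorm_ge0 ?sqrtr_ge0.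
(* [psi k - v] is a limit of elements of [W], all orthogonal to [v]. *)
have kv : inner (psi k) v = inner v v.
  apply/eqP; rewrite -subr_eq0; apply/eqP.
  apply: (@rnorm_small_eq0 _ _ (_ : C^o) (rnorm v)) => e /hv[w Ww hw].
  have -> : inner (psi k) v - inner v v = inner ((psi k - w) - v) v.
    by rewrite !innerBl (innerC w v) (vW w Ww) conjc0 subr0.
  rewrite (le_trans (cauchy_schwarz _ _))// ler_wpM2r ?rnorm_ge0//.
  by rewrite rnorm_distC ltW.
exists (((inner v v)^-1)^*%C *: v) => j; rewrite innerZr conjcK.
have [->|jk] := eqVneq j k; first by rewrite kv mulVf.
have Wj : W (psi j).
  by exists [fset j]%fset, (fun=> 1); rewrite inE eq_sym jk big_seq_fset1 scale1r.
by rewrite (innerC (psi j)) (vW _ Wj) conjc0 mulr0.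
Qed.

Lemma biorthogonal_C psi psi' : biorthogonal psi psi' -> biorthogonal psi' psi.
Proof. by move=> h j k; rewrite innerC h conjc_nat eq_sym. Qed.

Lemma biorthogonal_coef psi psi' : biorthogonal psi psi' -> forall J c k,
  inner (\sum_(j <- J) c j *: psi j) (psi' k) = if k \in J then c k else 0.
Proof.
move=> h J c k; rewrite inner_suml; case: ifPn => kJ.
  rewrite (big_fsetD1 k)//= innerZl h eqxx mulr1 big_seq big1 ?addr0// => j.
  by rewrite !inE innerZl h => /andP[/negbTE -> _]; rewrite mulr0.
rewrite big_seq big1// => j jJ; rewrite innerZl h; case: eqP => [jk|_].
  by rewrite -jk jJ in kJ.
by rewrite mulr0.
Qed.

(** For [x] in the span of [psi], the numbers [inner x (psi' k)] are its coefficients, so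
    Cauchy-Schwarz and the lower bound give [rnorm (inner x g) <= Num.sqrt M * rnorm x]. Density
    extends this to [x = g], where it bounds [rnorm g]. *)
Lemma biorthogonal_riesz_upper psi psi' A : complete_seq psi ->
  riesz_lower psi A -> biorthogonal psi psi' -> riesz_upper psi' A^-1.
Proof.
move=> cpl [A0 hA] bio; split=> [|J a]; first by rewrite invr_ge0 ltW.
set g := \sum_(k <- J) _; set M := A^-1 * sqsum a J.
have M0 : 0 <= M by rewrite mulr_ge0 ?sqsum_ge0// invr_ge0 ltW.
have := dense_bounded_op (inner_bounded_op g) cpl (sqrtr_ge0 M).
move=> /(_ _ g); rewrite inner_rnorm rnorm_real ?sqr_ge0// => h.
have {h} : rnorm g ^+ 2 <= Num.sqrt M * rnorm g.
  apply: h => _ [J' [c ->]]; set x := \sum_(k <- J') _.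
  rewrite /g inner_sumr.
  apply: (@le_trans _ _ (\sum_(k <- J) rnorm (a k : C^o) * rnorm (inner x (psi' k) : C^o))).
    elim/big_ind2: _ => [|y y' z z' hy hz|k _]; first by rewrite rnorm0.
      by rewrite (le_trans (rnormD _ _))// lerD.
    by rewrite innerZr rnormM /rnorm normcJ.
  rewrite (le_trans (sum_mul_le_sqrt _ _ _))//; try by move=> k; exact: rnorm_ge0.
  rewrite -/(sqsum a J) -/(sqsum (fun k => inner x (psi' k)) J) mulrC.
  rewrite /M sqrtrM ?invr_ge0 ?(ltW A0)// mulrAC ler_wpM2r ?sqrtr_ge0//.
  rewrite -[rnorm x]ger0_norm ?rnorm_ge0// -sqrtr_sqr -sqrtrM ?invr_ge0 ?(ltW A0)//.
  rewrite ler_wsqrtr// ler_pdivlMl// (le_trans _ (hA J' c))// ler_pM2l//.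
  (* The coefficients of [x] vanish outside [J'], so enlarging to the union changes nothing and
     makes room for [J]. *)
  have -> : sqsum c J' = sqsum (fun k => inner x (psi' k)) (J `|` J')%fset.
    rewrite /sqsum -(big_fset_incl _ (fsubsetUr J J')); last first.
      move=> k _ /negbTE kJ'; rewrite (biorthogonal_coef bio) kJ'.
      by rewrite rnorm0 expr0n.
    rewrite big_seq [RHS]big_seq; apply: eq_bigr => k kJ'.
    by rewrite (biorthogonal_coef bio) kJ'.
  by rewrite /sqsum (big_fset_subD _ (fsubsetUl J J')) lerDl sqsum_ge0.
have [->|g0] := eqVneq (rnorm g) 0; first by rewrite expr0n.
have {}g0 : 0 < rnorm g by rewrite lt_def g0 rnorm_ge0.
rewrite expr2 ler_pM2r// => h.
rewrite -(sqr_sqrtr M0) expr2 -expr2.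
by rewrite ler_pXn2r ?nnegrE ?rnorm_ge0 ?sqrtr_ge0.
Qed.

End RieszBasis.

(** * Expansions in a Riesz basis and its canonical dual *)

Section DualPair.
Variables (R : realType) (K : countType) (H : hilbertType R).
Local Notation C := R[i].
Implicit Types (psi : K -> H) (c : K -> C).

(** The functional [inner _ (u - w)] vanishes on a dense span, hence at [u - w] itself. *)
Lemma complete_seq_eq psi u w : complete_seq psi ->
  (forall k, inner u (psi k) = inner w (psi k)) -> u = w.
Proof.
move=> cpl h; apply/eqP; rewrite -subr_eq0; apply/eqP; set z := u - w.
have hz k : inner (psi k) z = 0.
  by rewrite innerC /z innerBl h subrr conjc0.
have b0 : bounded_op H C^o (fun=> 0).
  by apply: (@bounded_op_bound _ _ _ _ 0) => [a x y|x]; rewrite ?scaler0 ?addr0// rnorm0 mul0r.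
have /(congr1 (fun f => f z)) : (fun x => inner x z : C^o) = (fun=> 0).
  apply: (eq_bounded_op (inner_bounded_op z) b0 cpl) => _ [J [c ->]].
  by rewrite inner_suml big1// => k _; rewrite innerZl hz mulr0.
by rewrite inner_normE => /eqP; rewrite sqrf_eq0 normr_eq0 => /eqP.
Qed.

Lemma synthesis_ZD psi B (a : C) c d : riesz_upper psi B -> l2 c -> l2 d ->
  usum (fun k => (a * c k + d k) *: psi k)
  = a *: usum (fun k => c k *: psi k) + usum (fun k => d k *: psi k).
Proof.
move=> uB hc hd; apply: has_usumE.
under eq_fun do rewrite scalerDl -scalerA.
by apply: has_usum_ZD; apply: (synthesis_has_usum uB).
Qed.

Lemma synthesis_analysis_bounded_op psi psi' B B' :
  riesz_upper psi B -> riesz_upper psi' B' ->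
  bounded_op H H (fun f => usum (fun k => inner f (psi' k) *: psi k)).
Proof.
move=> uB uB'; have BB0 : 0 <= B * B' by rewrite mulr_ge0 ?uB.1 ?uB'.1.
apply: (@bounded_op_bound _ _ _ _ (Num.sqrt (B * B'))) => [a f g|f].
  under eq_fun do rewrite innerDl innerZl.
  by apply: (synthesis_ZD _ uB); exact: (l2_analysis uB').
rewrite -[rnorm f]ger0_norm ?rnorm_ge0// -sqrtr_sqr -sqrtrM//.
rewrite -[leLHS]ger0_norm ?rnorm_ge0// -sqrtr_sqr ler_wsqrtr//.
by rewrite -mulrA; apply: rnorm_synthesis_le => // J; exact: bessel.
Qed.

(** Continuity moves the inner product inside the series, where biorthogonality leaves one term. *)
Lemma synthesis_coef psi psi' B c j : biorthogonal psi psi' ->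
  riesz_upper psi B -> l2 c ->
  inner (usum (fun k => c k *: psi k)) (psi' j) = c j.
Proof.
move=> bio uB hc.
have := has_usum_bounded_op (inner_bounded_op (psi' j)) (synthesis_has_usum uB hc).
move=> /has_usumE <-; have -> : c j = \sum_(k <- [fset j]%fset) inner (c k *: psi k) (psi' j).
  by rewrite big_seq_fset1 innerZl bio eqxx mulr1.
apply/has_usumE/has_usum_fin => k; rewrite inE => kj.
by rewrite /= innerZl bio (negbTE kj) mulr0.
Qed.

(** Both sides are bounded operators in [f], and on finite combinations of [psi] the series
    terminates. *)
Lemma reconstruction psi psi' B B' : complete_seq psi -> biorthogonal psi psi' ->
  riesz_upper psi B -> riesz_upper psi' B' ->
  forall f, usum (fun k => inner f (psi' k) *: psi k) = f.
Proof.
move=> cpl bio uB uB' f.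
have := eq_bounded_op (synthesis_analysis_bounded_op uB uB') (bounded_op_id H) cpl.
move=> /(_ _)/(congr1 (fun T => T f)); apply => _ [J [c ->]] /=.
apply: has_usumE; set x := \sum_(k <- J) _.
rewrite [X in has_usum _ X](_ : _ = \sum_(k <- J) inner x (psi' k) *: psi k).
  by apply: has_usum_fin => k /negbTE kJ; rewrite (biorthogonal_coef bio) kJ scale0r.
rewrite {1}/x big_seq [RHS]big_seq; apply: eq_bigr => k kJ.
by rewrite (biorthogonal_coef bio) kJ.
Qed.

(** The interface of the matrix calculus, invariant under exchange of the two sequences: each result
    on a basis also applies to its dual. *)
Definition dual_pair psi psi' : Prop :=
  [/\ exists B, riesz_upper psi B, exists B, riesz_upper psi' B, biorthogonal psi psi',
      forall f, usum (fun k => inner f (psi' k) *: psi k) = f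
    & forall f, usum (fun k => inner f (psi k) *: psi' k) = f].

Lemma dual_pair_sym psi psi' : dual_pair psi psi' -> dual_pair psi' psi.
Proof. by move=> [hB hB' bio r r']; split=> //; exact: biorthogonal_C. Qed.

Lemma riesz_basis_dual_pair psi : riesz_basis psi ->
  dual_pair psi (canonical_dual psi).
Proof.
move=> rpsi; have [[A lA] [B uB]] := riesz_basis_bounds rpsi.
have [cpl _] := rpsi; have [psi' bio] := biorthogonal_exists lA.
have uA := biorthogonal_riesz_upper cpl lA bio.
suff -> : canonical_dual psi = psi'.
  split=> //; [by exists B|by exists A^-1|exact: reconstruction bio uB uA|move=> f].
  (* The second expansion is tested against [psi], whose completeness is known: both sides have
     inner product [inner f (psi j)] with [psi j]. *)
  apply: (complete_seq_eq cpl) => j.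
  exact: (synthesis_coef j (biorthogonal_C bio) uA (l2_analysis uB f)).
(* Pairing [frame_op psi f] with [psi' j] returns [inner f (psi j)], and these numbers determine
   [f]. *)
have inj : {in [set: H] &, injective (frame_op psi)}.
  move=> f g _ _ fg; apply: (complete_seq_eq cpl) => j.
  rewrite -(synthesis_coef j bio uB (l2_analysis uB f)).
  rewrite -(synthesis_coef j bio uB (l2_analysis uB g)).
  by move: fg; rewrite /frame_op => ->.
apply/funext => k; rewrite /canonical_dual.
have {1}<- : frame_op psi (psi' k) = psi k.
  apply: has_usumE.
  have -> : psi k = \sum_(j <- [fset k]%fset) inner (psi' k) (psi j) *: psi j.
    by rewrite big_seq_fset1 (biorthogonal_C bio) eqxx scale1r.
  apply: has_usum_fin => j; rewrite inE eq_sym => jk.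
  by rewrite (biorthogonal_C bio) (negbTE jk) scale0r.
by rewrite (pinvKV _ inj)// inE.
Qed.

End DualPair.

(** * Bounded matrices acting on square-summable sequences *)

Section BoundedMatrices.
Variables (R : realType) (K : countType).
Local Notation C := R[i].
Implicit Types (A : infmx R K) (c d : K -> C).

Lemma bounded_mx_sqsum A : bounded_mx A -> exists2 B : R, 0 <= B &
  forall c s, (forall J, sqsum c J <= s) -> forall J, sqsum (mxapp A c) J <= B * s.
Proof.
move=> [B hB]; exists (B ^+ 2); first exact: sqr_ge0.
move=> c s hs; apply/l2sqnorm_leP; have [_ h] := hB c (l2_leP hs).
by rewrite (le_trans h)// (EFinM (B ^+ 2)) lee_wpmul2l ?lee_fin ?sqr_ge0//; exact/l2sqnorm_leP.
Qed.

Lemma mxapp_has_usum A c j : bounded_mx A -> l2 c ->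
  has_usum (fun k => A j k * c k : C^o) (mxapp A c j).
Proof. by move=> [B hB] hc; apply: usum_has; exact: (hB c hc).1. Qed.

Lemma l2_sqsum c : l2 c -> exists s, forall J, sqsum c J <= s.
Proof.
move=> /l2sqnorm_fin[s _ hs]; exists s => J; move: J.
by apply/l2sqnorm_leP; rewrite hs.
Qed.

Lemma l2_mxapp A c : bounded_mx A -> l2 c -> l2 (mxapp A c).
Proof.
move=> /bounded_mx_sqsum[B _ hB] /l2_sqsum[s hs]; exact: l2_leP (hB c s hs).
Qed.

Lemma mxapp_ZD A (a : C) c d : bounded_mx A -> l2 c -> l2 d ->
  mxapp A (fun k => a * c k + d k) = (fun j => a * mxapp A c j + mxapp A d j).
Proof.
move=> bA hc hd; apply/funext => j; rewrite [LHS]/mxapp.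
under eq_fun do rewrite mulrDr mulrCA.
exact: has_usumE (has_usum_ZD a (mxapp_has_usum j bA hc) (mxapp_has_usum j bA hd)).
Qed.

End BoundedMatrices.

(** * Operators and their matrices *)

Section MatrixRepresentation.
Variables (R : realType) (K : countType) (H1 H2 : hilbertType R).
Local Notation C := R[i].
Variables (Psi Psi' : K -> H1) (Phi Phi' : K -> H2).
Hypotheses (dPsi : dual_pair Psi Psi') (dPhi : dual_pair Phi Phi').

(** The matrix of [T] acts as synthesis with [Psi], then [T], then analysis with [Phi], because [T]
    passes through the series. *)
Lemma mx_of_op_app (T : H1 -> H2) (c : K -> C) j : bounded_op H1 H2 T -> l2 c ->
  has_usum (fun k => mx_of_op Phi Psi T j k * c k : C^o)
    (inner (T (usum (fun k => c k *: Psi k))) (Phi j)).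
Proof.
move=> bT hc; have [[B uB] _ _ _ _] := dPsi.
have := has_usum_bounded_op (bounded_op_comp (inner_bounded_op (Phi j)) bT)
  (synthesis_has_usum uB hc).
rewrite (_ : _ \o _ = (fun k => mx_of_op Phi Psi T j k * c k : C^o))//.
by apply/funext => k; rewrite /= (bounded_opZ bT) innerZl mulrC.
Qed.

Lemma mxapp_mx_of_op (T : H1 -> H2) (c : K -> C) : bounded_op H1 H2 T -> l2 c ->
  mxapp (mx_of_op Phi Psi T) c
  = fun j => inner (T (usum (fun k => c k *: Psi k))) (Phi j).
Proof. by move=> bT hc; apply/funext => j; exact: (has_usumE (mx_of_op_app j bT hc)). Qed.

Lemma mx_of_op_bounded (T : H1 -> H2) : bounded_op H1 H2 T ->
  bounded_mx (mx_of_op Phi Psi T).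
Proof.
move=> bT; have [[B uB] _ _ _ _] := dPsi; have [[B' uB'] _ _ _ _] := dPhi.
have [N N0 hN] := bounded_op_rnorm bT.
have B0 := uB.1; have B'0 := uB'.1.
(* The factors come from analysis, [T] and synthesis; the root is there because [bounded_mx] squares
   its constant. *)
exists (Num.sqrt (B' * (N ^+ 2 * B))) => c hc; split=> [j|].
  exact: has_usum_summable (mx_of_op_app j bT hc).
rewrite sqr_sqrtr ?mulr_ge0 ?sqr_ge0//.
have [s s0 hs] := l2sqnorm_fin hc; rewrite hs -EFinM; apply/l2sqnorm_leP => J.
have {}hs : forall J, sqsum c J <= s by apply/l2sqnorm_leP; rewrite hs.
rewrite mxapp_mx_of_op// (le_trans (bessel uB' _ _))// -mulrA ler_wpM2l//.
apply: (@le_trans _ _ ((N * rnorm (usum (fun k => c k *: Psi k))) ^+ 2)).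
  by rewrite ler_pXn2r ?nnegrE ?mulr_ge0 ?rnorm_ge0.
rewrite exprMn -(mulrA (N ^+ 2) B) ler_wpM2l ?sqr_ge0//.
exact: rnorm_synthesis_le uB hs.
Qed.

Lemma op_of_mx_bounded (A : infmx R K) : bounded_mx A ->
  bounded_op H1 H2 (op_of_mx Phi' Psi' A).
Proof.
move=> bA; have [_ [B uB] _ _ _] := dPsi; have [_ [B' uB'] _ _ _] := dPhi.
have [N N0 hN] := bounded_mx_sqsum bA.
have B0 := uB.1; have B'0 := uB'.1.
have opE h : op_of_mx Phi' Psi' A h =
    usum (fun k => mxapp A (fun j => inner h (Psi' j)) k *: Phi' k) by [].
(* Here [N] already bounds squared norms, so it enters unsquared. *)
apply: (@bounded_op_bound _ _ _ _ (Num.sqrt (B' * (N * B)))) => [a f g|f].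
  rewrite !opE (_ : (fun j => _) = fun j => a * inner f (Psi' j) + inner g (Psi' j)).
    rewrite (mxapp_ZD a bA (l2_analysis uB f) (l2_analysis uB g)).
    by apply: (synthesis_ZD _ uB'); apply: l2_mxapp => //; exact: (l2_analysis uB).
  by apply/funext => j; rewrite innerDl innerZl.
have C0 : 0 <= B' * (N * B) by rewrite !mulr_ge0.
rewrite -[rnorm f]ger0_norm ?rnorm_ge0// -sqrtr_sqr -sqrtrM//.
rewrite -[leLHS]ger0_norm ?rnorm_ge0// -sqrtr_sqr ler_wsqrtr//.
rewrite -!mulrA opE; apply: rnorm_synthesis_le => //; apply: hN => J.
exact: bessel.
Qed.

(** Reconstruction of [h] turns the matrix action into the coefficients [inner (T h) (Phi k)], and
    synthesis with [Phi'] rebuilds [T h]. *)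
Lemma mx_of_opK (T : H1 -> H2) : bounded_op H1 H2 T ->
  op_of_mx Phi' Psi' (mx_of_op Phi Psi T) = T.
Proof.
move=> bT; have [_ [B' uB'] _ r _] := dPsi; have [_ _ _ _ r'] := dPhi.
apply/funext => h; rewrite -[RHS]r'.
transitivity (usum (fun k =>
    mxapp (mx_of_op Phi Psi T) (fun j => inner h (Psi' j)) k *: Phi' k)) => //.
by rewrite (mxapp_mx_of_op bT (l2_analysis uB' h)) /= r.
Qed.

(** Analysis of [Psi n] by [Psi'] is the [n]-th unit vector, and pairing with [Phi m] extracts the
    [m]-th entry of its image under [A]. *)
Lemma op_of_mxK (A : infmx R K) : bounded_mx A ->
  mx_of_op Phi Psi (op_of_mx Phi' Psi' A) = A.
Proof.
move=> bA; have [_ [B uB] bio _ _] := dPsi; have [_ [B' uB'] bio' _ _] := dPhi.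
apply/funext => m; apply/funext => n; rewrite /mx_of_op.
rewrite (synthesis_coef m (biorthogonal_C bio') uB'
  (l2_mxapp bA (l2_analysis uB (Psi n)))).
apply: has_usumE.
have -> : A m n = \sum_(k <- [fset n]%fset) A m k * inner (Psi n) (Psi' k).
  by rewrite big_seq_fset1 bio eqxx mulr1.
apply: has_usum_fin => k; rewrite inE eq_sym => kn.
by rewrite bio (negbTE kn) mulr0.
Qed.

End MatrixRepresentation.

(** * Bijections and algebra isomorphisms *)

Lemma set_bij_inverse (T U : Type) (A : set T) (B : set U) (f : T -> U) (g : U -> T) :
  (forall x, A x -> B (f x)) -> (forall y, B y -> A (g y)) ->
  (forall x, A x -> g (f x) = x) -> (forall y, B y -> f (g y) = y) ->
  set_bij A B f.
Proof.
move=> AB BA fK gK; split=> [x|x y /set_mem Ax /set_mem Ay fxy|y By].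
- exact: AB.
- by rewrite -(fK x)// fxy fK.
- by exists (g y); [exact: BA|exact: gK].
Qed.

(** Expanding [T (Psi n)] in [Phi'] with coefficients against [Phi] and applying [S] termwise gives
    the matrix product. *)
Lemma mx_of_op_comp (R : realType) (K : countType) (H1 H2 H3 : hilbertType R)
    (Psi : K -> H1) (Phi Phi' : K -> H2) (Xi : K -> H3)
    (S : H2 -> H3) (T : H1 -> H2) :
  dual_pair Phi Phi' -> bounded_op H2 H3 S ->
  mx_of_op Xi Psi (S \o T) = mxprod (mx_of_op Xi Phi' S) (mx_of_op Phi Psi T).
Proof.
move=> dPhi bS; have [[B uB] _ _ _ r] := dPhi.
apply/funext => m; apply/funext => n; rewrite /mxprod.
rewrite (has_usumE (mx_of_op_app Xi (dual_pair_sym dPhi) m bS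
  (l2_analysis uB (T (Psi n))))).
by rewrite r.
Qed.

Section Isomorphisms.
Variables (R : realType) (K : countType) (H : hilbertType R).
Variables (Phi Phi' : K -> H).
Hypothesis dPhi : dual_pair Phi Phi'.

Lemma mx_of_op_id : mx_of_op Phi Phi' id = mxid.
Proof.
have [_ _ bio _ _] := dPhi.
apply/funext => m; apply/funext => n.
by rewrite /mx_of_op (biorthogonal_C bio) eq_sym.
Qed.

Lemma mx_of_op_iso :
  algebra_iso (bounded_op H H) (@comp H H H) bounded_mx mxprod (mx_of_op Phi Phi').
Proof.
have dPhi' := dual_pair_sym dPhi; split.
(* The inverse uses the dual of each sequence: [Phi'] for [Phi], and [Phi] for [Phi']. *)
- apply: (set_bij_inverse (g := op_of_mx Phi' Phi)).
  + exact: mx_of_op_bounded dPhi' dPhi.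
  + exact: op_of_mx_bounded dPhi' dPhi.
  + exact: mx_of_opK dPhi' dPhi.
  + exact: op_of_mxK dPhi' dPhi.
- move=> a S T _ _; apply/funext => m; apply/funext => n.
  by rewrite /mx_of_op innerDl innerZl.
- by move=> S T bS bT; exact: mx_of_op_comp.
Qed.

End Isomorphisms.

(** Writing [x = f (g x)] transports the laws of [f] to [g]; closure of [A] allows [g] to cancel [f]
    on the results. *)
Lemma algebra_iso_inverse (R : realType) (V W : lmodType R[i])
    (A : set V) (mulA : V -> V -> V) (B : set W) (mulB : W -> W -> W)
    (f : V -> W) (g : W -> V) :
  algebra_iso A mulA B mulB f -> set_fun B A g ->
  (forall x, A x -> g (f x) = x) -> (forall y, B y -> f (g y) = y) ->
  (forall a x y, A x -> A y -> A (a *: x + y)) ->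
  (forall x y, A x -> A y -> A (mulA x y)) ->
  algebra_iso B mulB A mulA g.
Proof.
move=> [[fAB _ _] lf mf] gBA fK gK AZD AM; split.
- exact: set_bij_inverse gBA fAB gK fK.
- move=> a x y Bx By; rewrite -{1}(gK x Bx) -{1}(gK y By).
  by rewrite -lf ?fK//; [apply: AZD| |]; exact: gBA.
- move=> x y Bx By; rewrite -{1}(gK x Bx) -{1}(gK y By).
  by rewrite -mf ?fK//; [apply: AM| |]; exact: gBA.
Qed.

(** The identity has as matrix the cross-Gram matrix of [Psi] and [Phi]. This is [mxid] exactly
    under biorthogonality, and completeness of [Phi] makes the biorthogonal sequence unique; hence
    an equivalence for general [Psi]. *)
Lemma mx_of_op_idP (R : realType) (K : countType) (H : hilbertType R)
    (Psi Phi : K -> H) : riesz_basis Phi ->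
  mx_of_op Phi Psi id = mxid <-> Psi = canonical_dual Phi.
Proof.
move=> rPhi; have dPhi := riesz_basis_dual_pair rPhi.
split=> [h|->]; last exact: mx_of_op_id.
apply/funext => n; apply: (complete_seq_eq rPhi.1) => m.
have /(congr1 (fun A => A m n)) := h; rewrite -(mx_of_op_id dPhi); exact.
Qed.

Theorem theorem3p5 (R : realType) (K : countType) :
  (forall (H1 H2 : hilbertType R) (Psi : K -> H1) (Phi : K -> H2),
     infinite_dimensional H1 -> infinite_dimensional H2 ->
     riesz_basis Psi -> riesz_basis Phi ->
     let M := mx_of_op Phi Psi in
     let O := op_of_mx (canonical_dual Phi) (canonical_dual Psi) in
     [/\ set_bij (bounded_op H1 H2) bounded_mx M,
         set_bij bounded_mx (bounded_op H1 H2) O,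
         (forall T, bounded_op H1 H2 T -> O (M T) = T)
       & (forall A, bounded_mx A -> M (O A) = A)])
  /\
  (forall (H : hilbertType R) (Psi Phi : K -> H),
     infinite_dimensional H -> riesz_basis Psi -> riesz_basis Phi ->
     (mx_of_op Phi Psi id = mxid <-> Psi = canonical_dual Phi) /\
     (op_of_mx (canonical_dual Phi) (canonical_dual Psi) mxid = id
        <-> Psi = canonical_dual Phi))
  /\
  (forall (H : hilbertType R) (Phi : K -> H),
     infinite_dimensional H -> riesz_basis Phi ->
     let M := mx_of_op Phi (canonical_dual Phi) in
     let O := op_of_mx Phi (canonical_dual Phi) in
     [/\ algebra_iso (bounded_op H H) (@comp H H H)
                     bounded_mx mxprod M,
         algebra_iso bounded_mx mxprod
                     (bounded_op H H) (@comp H H H) O,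
         M id = mxid
       & O mxid = id]).
Proof.
split; last split.
- move=> H1 H2 Psi Phi _ _ /riesz_basis_dual_pair dPsi /riesz_basis_dual_pair dPhi M O.
  have MB := mx_of_op_bounded dPsi dPhi; have OB := op_of_mx_bounded dPsi dPhi.
  have MK := mx_of_opK dPsi dPhi; have OK := op_of_mxK dPsi dPhi.
  by split=> //; [exact: set_bij_inverse MB OB MK OK|exact: set_bij_inverse OB MB OK MK].
- move=> H Psi Phi _ /riesz_basis_dual_pair dPsi rPhi.
  have dPhi := riesz_basis_dual_pair rPhi.
  have MK := mx_of_opK dPsi dPhi; have OK := op_of_mxK dPsi dPhi.
  (* [mxid] is the matrix of the bounded operator [id] for the dual pair of [Phi]. *)
  have bid : bounded_mx (@mxid R K).
    rewrite -(mx_of_op_id dPhi).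
    exact: mx_of_op_bounded (dual_pair_sym dPhi) dPhi _ (bounded_op_id H).
  have idP := mx_of_op_idP Psi rPhi; split=> //; split=> [h|/idP h].
    by apply/idP; rewrite -h OK.
  by rewrite -h MK//; exact: bounded_op_id.
- move=> H Phi _ rPhi M O; have dPhi := riesz_basis_dual_pair rPhi.
  have dPhi' := dual_pair_sym dPhi.
  (* This [O] inverts the matrix map with the two sequences exchanged, not [M] itself. *)
  have MK := mx_of_opK dPhi dPhi'.
  split; [exact: mx_of_op_iso| |exact: mx_of_op_id|].
    apply: (algebra_iso_inverse (mx_of_op_iso dPhi')) MK _ _ _.
    + exact: op_of_mx_bounded dPhi dPhi'.
    + exact: op_of_mxK dPhi dPhi'.
    + by move=> a S T; exact: bounded_op_ZD.
    + by move=> S T; exact: bounded_op_comp.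
  by rewrite -[RHS](MK _ (bounded_op_id H)) (mx_of_op_id dPhi').
Qed.
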